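(* Let $q\in\mathbf{C}^\times$, and let $L$, $\Lambda$ and $H$ be the Lefschetz operator, dual Lefschetz operator and counting operator on the differential forms $\Omega^\bullet_q(S^2)$ of the standard Podleś sphere, which define a representation of $\mathfrak{sl}_2$ on $\Omega^\bullet_q(S^2)$. This representation splits into a direct sum of sub-representations according to $$\Omega^\bullet_q(S^2)=\bigl(\mathbf{C}_q[S^2]\oplus\Omega^2_q(S^2)\bigr)\oplus\Omega^1_q(S^2).$$
   Context: Algebra. $q\in\mathbf{C}^\times$. $\mathbf{C}_q[SU_2]$ is the Hopf $*$-algebra generated by $a,b,c,d$ with $ab=qba$, $ac=qca$, $bd=qdb$, $cd=qdc$, $bc=cb$, $ad-da=(q-q^{-1})bc$, $ad-qbc=1$. It is $\mathbf{Z}$-graded by $\deg a=\deg c=-1$, $\deg b=\deg d=1$; $\mathcal{E}_k$ is the degree-$k$ part, and the Podleś sphere is $\mathbf{C}_q[S^2]=\mathcal{E}_0$. Forms. The graded algebra of forms is $\Omega^\bullet_q(S^2)=\Omega^0_q(S^2)\oplus\Omega^1_q(S^2)\oplus\Omega^2_q(S^2)$ with $\Omega^0_q(S^2)=\mathcal{E}_0$, $\Omega^1_q(S^2)=\mathcal{E}_2e^+\oplus\mathcal{E}_{-2}e^-$, $\Omega^2_q(S^2)=\mathcal{E}_0\tau$, where $e^+,e^-,\tau$ are basis elements (the classes of $\mathrm{d}b_+$, $\mathrm{d}b_-$, $\mathrm{d}b_+\wedge \mathrm{d}b_-$ with $b_+=cd$, $b_-=ab$). For $f,f'\in\mathcal{E}_2$,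 $g,g'\in\mathcal{E}_{-2}$: $(fe^+)\wedge(ge^-)=fg\,\tau$, $(ge^-)\wedge(fe^+)=-q^2gf\,\tau$, $(fe^+)\wedge(f'e^+)=0=(ge^-)\wedge(g'e^-)$; products of total degree $>2$ vanish. Operators. The Hodge map is given by $\ast_H(m)=m\tau$, $\ast_H(m\tau)=m$, $\ast_H(fe^+)=i\,fe^+$, $\ast_H(ge^-)=-i\,ge^-$ ($m\in\mathcal{E}_0$, $f\in\mathcal{E}_2$, $g\in\mathcal{E}_{-2}$). The fundamental form is $\kappa=-e^+\wedge e^-=-\tau$; the Lefschetz operator is $L(\omega)=\omega\wedge\kappa$; the dual Lefschetz operator is $\Lambda=\ast_H^{-1}\circ L\circ\ast_H$; the counting operator is $H=\sum_{k=0}^2(k-1)\Pi^k$ with $\Pi^k$ the projection of $\Omega^\bullet_q(S^2)$ onto $\Omega^k_q(S^2)$. They satisfy $[H,L]=2L$, $[H,\Lambda]=-2\Lambda$, $[L,\Lambda]=H$. *)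

(* Defs.v *)
From HB Require Import structures.
From mathcomp Require Import all_boot all_order all_algebra.
From mathcomp Require Import finmap.
From mathcomp Require Import boolp classical_sets reals.
From mathcomp Require Import complex.
From mathcomp.multinomials Require Import monalg.

Set Implicit Arguments.
Unset Strict Implicit.
Unset Printing Implicit Defensive.

Import Order.TTheory GRing.Theory Num.Theory.
Local Open Scope ring_scope.
Local Open Scope quotient_scope.
Local Open Scope classical_set_scope.

(* The library only has quotients of commutative rings by ideals. *)
Definition two_sided_ideal (A : nzRingType) (J : set A) : Prop :=
  [/\ J 0, forall x y, J x -> J y -> J (x + y)
    & forall u x v, J x -> J (u * x * v)].

Definition ideal_generated (A : nzRingType) (S : set A) : set A :=
  [set x | forall J : set A, two_sided_ideal J -> S `<=` J -> J x].

Lemma ideal_generated_ideal (A : nzRingType) (S : set A) :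
  two_sided_ideal (ideal_generated S).
Proof.
split=> [J [] //|x y Sx Sy J JJ SJ|u x v Sx J JJ SJ]; have [_ JD JM] := JJ.
  by apply: JD; [apply: Sx|apply: Sy].
by apply: JM; apply: Sx.
Qed.

(* The generators are the matrix entries of u = (a b; c d), so they are indexed *)
(* by a row and a column.                                                      *)
Definition su2_gen : choiceType := ('I_2 * 'I_2)%type.

Definition su2_free (R : realType) : lalgType R[i] := {malg R[i][{fmonom su2_gen}]}.

Definition free_gen (R : realType) (x : su2_gen) : su2_free R := << fmu x >>.

Definition su2_relators (K : fieldType) (q : K) (A : lalgType K) (a b c d : A) :
    seq A :=
  [:: a * b - q *: (b * a);
      a * c - q *: (c * a);
      b * d - q *: (d * b);
      c * d - q *: (d * c);
      b * c - c * b;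
      a * d - d * a - (q - q^-1) *: (b * c);
      a * d - q *: (b * c) - 1].

Definition su2_relations (R : realType) (q : R[i]) : set (su2_free R) :=
  [set` su2_relators q (free_gen R (0, 0)) (free_gen R (0, 1))
                       (free_gen R (1, 0)) (free_gen R (1, 1))].

Definition su2_ideal (R : realType) (q : R[i]) : {pred su2_free R} :=
  fun x => `[< ideal_generated (su2_relations q) x >].

Section QuantumSU2.
Context (R : realType) (q : R[i]).
Local Notation free := (su2_free R).
Local Notation I := (su2_ideal q).

Lemma su2_idealM u x v : x \in I -> u * x * v \in I.
Proof.
have [_ _ IM] := ideal_generated_ideal (su2_relations q).
by move=> /asboolP Ix; apply/asboolP; apply: IM.
Qed.

Lemma su2_idealMl u x : x \in I -> u * x \in I.
Proof. by move=> Ix; rewrite -[u * x]mulr1; apply: su2_idealM. Qed.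

Lemma su2_idealMr v x : x \in I -> x * v \in I.
Proof. by move=> Ix; rewrite -[x]mul1r; apply: su2_idealM. Qed.

Fact su2_ideal_zmod_closed : zmod_closed I.
Proof.
have [I0 ID _] := ideal_generated_ideal (su2_relations q).
split; first exact/asboolP.
move=> x y /asboolP Ix Iy; apply/asboolP; apply: ID => //; apply/asboolP.
by rewrite -mulN1r; apply: su2_idealMl.
Qed.

HB.instance Definition _ := GRing.isZmodClosed.Build free I su2_ideal_zmod_closed.

Lemma su2_relators_counit (A : lalgType R[i]) (e : {rmorphism A -> R[i]})
    (a b c d : A) :
    (forall k x, e (k *: x) = k * e x) ->
    e a = 1 -> e b = 0 -> e c = 0 -> e d = 1 ->
  {in su2_relators q a b c d, forall x, e x = 0}.
Proof.
move=> eZ ea eb ec ed x; rewrite !inE.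
by do 6?[case/orP]; move/eqP->;
  rewrite !(rmorphB, eZ, rmorphM, rmorph1) ?(ea, eb, ec, ed)
          ?(mulr0, mul0r, mulr1, subrr, subr0).
Qed.

(* The counit, used here only to see that the quotient below is nontrivial. *)
Definition counit_word (m : {fmonom su2_gen}) : R[i] :=
  \prod_(x <- (m : seq su2_gen)) (x.1 == x.2)%:R.

Fact counit_word_mmorphism : mmorphism counit_word.
Proof.
by split=> [m1 m2|]; rewrite /counit_word ?fmM ?big_cat //= fm1 big_nil.
Qed.

HB.instance Definition _ :=
  isMultiplicative.Build _ R[i] counit_word counit_word_mmorphism.

Definition free_counit : free -> R[i] := mmap idfun counit_word.

HB.instance Definition _ := GRing.RMorphism.on free_counit.

Lemma free_counit_gen x : free_counit (free_gen R x) = (x.1 == x.2)%:R.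
Proof.
by rewrite /free_counit /free_gen mmapU /= mul1r /counit_word fmU big_seq1.
Qed.

Lemma free_counitZ k x : free_counit (k *: x) = k * free_counit x.
Proof. exact: mmapZ. Qed.

Fact su2_ideal1 : 1 \notin I.
Proof.
apply/asboolP => /(_ [set x | free_counit x = 0]) /=.
rewrite rmorph1 => I1; suff /eqP : (1 : R[i]) = 0 by rewrite oner_eq0.
apply: I1.
  split=> /= [|x y x0 y0|u x v x0]; rewrite ?rmorph0 ?rmorphD ?rmorphM //=.
    by rewrite x0 y0 addr0.
  by rewrite x0 mulr0 mul0r.
apply: (su2_relators_counit (e := free_counit)); first exact: free_counitZ.
all: exact: free_counit_gen.
Qed.

Lemma free_scalerAr (k : R[i]) (x y : free) : k *: (x * y) = x * (k *: y).
Proof.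
have kC z : z * k%:MP = k *: z.
  rewrite -mul_malgC !malgM_def fgmulgU fgmulUg; apply: eq_bigr => m _.
  by rewrite mulm1 mul1m mulrC.
by rewrite -[in RHS]mul_malgC mulrA kC scalerAl.
Qed.

Definition su2 : Type := {ideal_quot I}.

HB.instance Definition _ := GRing.Zmodule.on su2.
HB.instance Definition _ := EqQuotient.on su2.

Definition su2_pi (x : free) : su2 := \pi_({ideal_quot I}) x.

Lemma su2_piP x y : reflect (su2_pi x = su2_pi y) (x - y \in I).
Proof. by rewrite Quotient.idealrBE; apply: eqP. Qed.

Lemma su2_reprK (u : su2) : su2_pi (repr u) = u.
Proof. exact: reprK. Qed.

Lemma su2_piB : zmod_morphism su2_pi.
Proof. exact: (raddfB (\pi_({ideal_quot I}))). Qed.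

HB.instance Definition _ := GRing.isZmodMorphism.Build free su2 su2_pi su2_piB.

Definition su2_one : su2 := su2_pi 1.
Definition su2_mul (u v : su2) : su2 := su2_pi (repr u * repr v).
Definition su2_scale (k : R[i]) (u : su2) : su2 := su2_pi (k *: repr u).

Lemma su2_pi_mul x y : su2_pi (x * y) = su2_mul (su2_pi x) (su2_pi y).
Proof.
apply/su2_piP; set x' := repr _; set y' := repr _.
have -> : x * y - x' * y' = (x - x') * y + x' * (y - y').
  by rewrite mulrBl mulrBr addrA subrK.
by apply: rpredD; [apply: su2_idealMr|apply: su2_idealMl];
  apply/su2_piP; rewrite su2_reprK.
Qed.

Lemma su2_pi_scale k x : su2_pi (k *: x) = su2_scale k (su2_pi x).
Proof.
apply/su2_piP; rewrite -scalerBr -[_ - _]mul1r scalerAl.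
by apply: su2_idealMl; apply/su2_piP; rewrite su2_reprK.
Qed.

Lemma su2_ind (P : su2 -> Prop) : (forall x, P (su2_pi x)) -> forall u, P u.
Proof. by move=> Px u; rewrite -(su2_reprK u). Qed.

Fact su2_mulA : associative su2_mul.
Proof.
elim/su2_ind=> x; elim/su2_ind=> y; elim/su2_ind=> z.
by rewrite -!su2_pi_mul mulrA.
Qed.

Fact su2_mul1 : left_id su2_one su2_mul.
Proof. by elim/su2_ind=> x; rewrite -su2_pi_mul mul1r. Qed.

Fact su2_mulr1 : right_id su2_one su2_mul.
Proof. by elim/su2_ind=> x; rewrite -su2_pi_mul mulr1. Qed.

Fact su2_mulDl : left_distributive su2_mul +%R.
Proof.
elim/su2_ind=> x; elim/su2_ind=> y; elim/su2_ind=> z.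
by rewrite -raddfD -!su2_pi_mul mulrDl raddfD.
Qed.

Fact su2_mulDr : right_distributive su2_mul +%R.
Proof.
elim/su2_ind=> x; elim/su2_ind=> y; elim/su2_ind=> z.
by rewrite -raddfD -!su2_pi_mul mulrDr raddfD.
Qed.

Fact su2_one_neq0 : su2_one != 0.
Proof.
rewrite -(raddf0 su2_pi); apply/eqP => /su2_piP.
by rewrite subr0; apply/negP/su2_ideal1.
Qed.

HB.instance Definition _ := GRing.Zmodule_isNzRing.Build su2
  su2_mulA su2_mul1 su2_mulr1 su2_mulDl su2_mulDr su2_one_neq0.

Fact su2_scaleA a b u : su2_scale a (su2_scale b u) = su2_scale (a * b) u.
Proof. by elim/su2_ind: u => x; rewrite -!su2_pi_scale scalerA. Qed.

Fact su2_scale1 : left_id 1 su2_scale.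
Proof. by elim/su2_ind=> x; rewrite -su2_pi_scale scale1r. Qed.

Fact su2_scaleDr : right_distributive su2_scale +%R.
Proof.
move=> k; elim/su2_ind=> x; elim/su2_ind=> y.
by rewrite -raddfD -!su2_pi_scale scalerDr raddfD.
Qed.

Fact su2_scaleDl u : {morph su2_scale^~ u : a b / a + b}.
Proof.
by elim/su2_ind: u => x a b /=; rewrite -!su2_pi_scale scalerDl raddfD.
Qed.

HB.instance Definition _ := GRing.Zmodule_isLmodule.Build R[i] su2
  su2_scaleA su2_scale1 su2_scaleDr su2_scaleDl.

Lemma su2_piM : {morph su2_pi : x y / x * y}.
Proof. exact: su2_pi_mul. Qed.

Lemma su2_piZ : scalable su2_pi.
Proof. exact: su2_pi_scale. Qed.

HB.instance Definition _ :=
  GRing.isMonoidMorphism.Build free su2 su2_pi (erefl, su2_piM).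
HB.instance Definition _ :=
  GRing.isScalable.Build R[i] free su2 *:%R su2_pi su2_piZ.

Fact su2_scalerAl (k : R[i]) (u v : su2) : k *: (u * v) = k *: u * v.
Proof.
elim/su2_ind: u => x; elim/su2_ind: v => y.
by rewrite -su2_piM -!su2_piZ -su2_piM scalerAl.
Qed.

HB.instance Definition _ :=
  GRing.Lmodule_isLalgebra.Build R[i] su2 su2_scalerAl.

Fact su2_scalerAr (k : R[i]) (u v : su2) : k *: (u * v) = u * (k *: v).
Proof.
elim/su2_ind: u => x; elim/su2_ind: v => y.
by rewrite -su2_piM -!su2_piZ -su2_piM free_scalerAr.
Qed.

HB.instance Definition _ :=
  GRing.Lalgebra_isAlgebra.Build R[i] su2 su2_scalerAr.

End QuantumSU2.

(* deg a = deg c = -1 (first column), deg b = deg d = 1 (second column). *)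
Definition gen_degree (x : su2_gen) : int := if x.2 == 0 then - 1 else 1.

Definition word_degree (m : {fmonom su2_gen}) : int :=
  \sum_(x <- (m : seq su2_gen)) gen_degree x.

Definition free_homogeneous (R : realType) (k : int) : {pred su2_free R} :=
  fun x => all (fun m => word_degree m == k) (msupp x).

Definition graded_part (R : realType) (q : R[i]) (k : int) : {pred su2 q} :=
  fun u => `[< exists2 x, x \in free_homogeneous k & su2_pi q x = u >].

Arguments graded_part {R} q k _.

Section Grading.
Context (R : realType).
Local Notation free := (su2_free R).

Lemma word_degreeM : {morph word_degree : m1 m2 / mmul m1 m2 >-> m1 + m2}.
Proof. by move=> m1 m2; rewrite /word_degree fmM big_cat. Qed.

Lemma homogeneousP k (x : free) :
  reflect {in msupp x, forall m, word_degree m = k} (x \in free_homogeneous k).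
Proof. by apply: (iffP allP) => xk m /xk /eqP. Qed.

Lemma homogeneous0 k : (0 : free) \in free_homogeneous k.
Proof. by apply/homogeneousP => m; rewrite msupp0. Qed.

Lemma homogeneousD k (x y : free) : x \in free_homogeneous k ->
  y \in free_homogeneous k -> x + y \in free_homogeneous k.
Proof.
move=> /homogeneousP xk /homogeneousP yk; apply/homogeneousP => m.
by move/(fsubsetP (msuppD_le _ _)); rewrite in_fsetU => /orP[/xk|/yk].
Qed.

Lemma homogeneousZ k c (x : free) :
  x \in free_homogeneous k -> c *: x \in free_homogeneous k.
Proof.
move=> /homogeneousP xk; apply/homogeneousP => m.
by move/(fsubsetP (msuppZ_le _ _))/xk.
Qed.

Lemma homogeneousM j k (x y : free) : x \in free_homogeneous j ->
  y \in free_homogeneous k -> x * y \in free_homogeneous (j + k).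
Proof.
move=> /homogeneousP xj /homogeneousP yk; apply/homogeneousP => m.
by move=> /msuppM_le[m1 [m2 [/xj <- /yk <- ->]]]; rewrite word_degreeM.
Qed.

Lemma homogeneous1 : (1 : free) \in free_homogeneous 0.
Proof.
apply/homogeneousP => m; move/(fsubsetP (msuppC_le _)); rewrite in_fset1 => /eqP->.
by rewrite /word_degree fm1 big_nil.
Qed.

Context (q : R[i]).

Fact graded_part_closed k : GRing.subsemimod_closed (graded_part q k).
Proof.
split=> [|c u].
  split; first by apply/asboolP; exists 0; rewrite ?homogeneous0 ?raddf0.
  move=> u v /asboolP[x xk <-] /asboolP[y yk <-]; apply/asboolP.
  by exists (x + y); rewrite ?homogeneousD ?raddfD.
move=> /asboolP[x xk <-]; apply/asboolP.
by exists (c *: x); rewrite ?homogeneousZ ?linearZ.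
Qed.

HB.instance Definition _ k :=
  GRing.isSubSemiModClosed.Build R[i] (su2 q) (graded_part q k)
    (graded_part_closed k).

Lemma graded_partM j k (u v : su2 q) : u \in graded_part q j ->
  v \in graded_part q k -> u * v \in graded_part q (j + k).
Proof.
move=> /asboolP[x xj <-] /asboolP[y yk <-]; apply/asboolP.
by exists (x * y); rewrite ?homogeneousM ?rmorphM.
Qed.

Lemma graded_part1 : 1 \in graded_part q 0.
Proof. by apply/asboolP; exists 1; rewrite ?homogeneous1 ?rmorph1. Qed.

End Grading.

Record degree_part (R : realType) (q : R[i]) (k : int) := DegreePart {
  degree_val :> su2 q;
  degree_valP : degree_val \in graded_part q k
}.

HB.instance Definition _ (R : realType) (q : R[i]) (k : int) :=
  [isSub for @degree_val R q k].
HB.instance Definition _ (R : realType) (q : R[i]) (k : int) :=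
  [Choice of degree_part q k by <:].
HB.instance Definition _ (R : realType) (q : R[i]) (k : int) :=
  [SubChoice_isSubLmodule of degree_part q k by <:].

Fact degree_mul_subproof (R : realType) (q : R[i]) (j k l : int) (jkl : j + k = l)
  (u : degree_part q j) (v : degree_part q k) :
  (u : su2 q) * (v : su2 q) \in graded_part q l.
Proof. by rewrite -jkl; apply: graded_partM; apply: degree_valP. Qed.

(* The product E_j x E_k -> E_(j+k); carrying an equation j + k = l avoids casts. *)
Definition degree_mul (R : realType) (q : R[i]) (j k l : int) (jkl : j + k = l)
    (u : degree_part q j) (v : degree_part q k) : degree_part q l :=
  DegreePart (degree_mul_subproof jkl u v).

Definition degree_one (R : realType) (q : R[i]) : degree_part q 0 :=
  DegreePart (graded_part1 q).

Definition podles_sphere (R : realType) (q : R[i]) : lmodType R[i] :=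
  degree_part q 0.

(* e^+, e^- and tau are formal basis elements: the tuple (m, (f, g), n) is the *)
(* form m + f e^+ + g e^- + n tau.                                             *)
Definition diff_form (R : realType) (q : R[i]) : Type :=
  (podles_sphere q * (degree_part q 2 * degree_part q (- 2)) * podles_sphere q)%type.

HB.instance Definition _ (R : realType) (q : R[i]) := GRing.Lmodule.on (diff_form q).

Section WedgeIdentities.
Context (K : fieldType) (q2 : K) (A : algType K).
Implicit Types m f g n : A.

Lemma wedge_part1A m m' m'' f f' f'' :
  m * (m' * f'' + f' * m'') + f * (m' * m'')
  = (m * m') * f'' + (m * f' + f * m') * m''.
Proof. by rewrite mulrDr mulrDl !mulrA !addrA. Qed.

Lemma wedge_part2A m m' m'' f f' f'' g g' g'' n n' n'' :
  m * (m' * n'' + f' * g'' - q2 *: (g' * f'') + n' * m'')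
    + f * (m' * g'' + g' * m'') - q2 *: (g * (m' * f'' + f' * m''))
    + n * (m' * m'')
  = (m * m') * n'' + (m * f' + f * m') * g''
    - q2 *: ((m * g' + g * m') * f'')
    + (m * n' + f * g' - q2 *: (g * f') + n * m') * m''.
Proof.
rewrite !(mulrDl, mulrDr) !mulrN !mulNr -!scalerAl -!scalerAr !scalerDr !mulrA.
rewrite !opprD !addrA.
by rewrite [LHS](ACl (1*2*5*3*7*4*6*8*9)).
Qed.

Lemma wedge_part1D m m' m'' f f' f'' :
  (m + m') * f'' + (f + f') * m'' = (m * f'' + f * m'') + (m' * f'' + f' * m'').
Proof. by rewrite !mulrDl addrACA. Qed.

Lemma wedge_part1Dr m m' m'' f f' f'' :
  m'' * (f + f') + f'' * (m + m') = (m'' * f + f'' * m) + (m'' * f' + f'' * m').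
Proof. by rewrite !mulrDr addrACA. Qed.

Lemma wedge_part2D m m' m'' f f' f'' g g' g'' n n' n'' :
  (m + m') * n'' + (f + f') * g'' - q2 *: ((g + g') * f'') + (n + n') * m''
  = (m * n'' + f * g'' - q2 *: (g * f'') + n * m'')
    + (m' * n'' + f' * g'' - q2 *: (g' * f'') + n' * m'').
Proof.
rewrite !mulrDl !scalerDr !opprD !addrA.
by rewrite [LHS](ACl (1*3*5*7*2*4*6*8)).
Qed.

Lemma wedge_part2Dr m m' m'' f f' f'' g g' g'' n n' n'' :
  m'' * (n + n') + f'' * (g + g') - q2 *: (g'' * (f + f')) + n'' * (m + m')
  = (m'' * n + f'' * g - q2 *: (g'' * f) + n'' * m)
    + (m'' * n' + f'' * g' - q2 *: (g'' * f') + n'' * m').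
Proof.
rewrite !mulrDr !scalerDr !opprD !addrA.
by rewrite [LHS](ACl (1*3*5*7*2*4*6*8)).
Qed.

Lemma wedge_part1Z k m m' f f' :
  k *: (m * f' + f * m') = (k *: m) * f' + (k *: f) * m'.
Proof. by rewrite scalerDr !scalerAl. Qed.

Lemma wedge_part1Zr k m m' f f' :
  k *: (m * f' + f * m') = m * (k *: f') + f * (k *: m').
Proof. by rewrite scalerDr !scalerAr. Qed.

Lemma wedge_part2Z k m m' f f' g g' n n' :
  k *: (m * n' + f * g' - q2 *: (g * f') + n * m')
  = (k *: m) * n' + (k *: f) * g' - q2 *: ((k *: g) * f') + (k *: n) * m'.
Proof.
by rewrite -!scalerAl !scalerDr scalerN !scalerA [q2 * k]mulrC.
Qed.

Lemma wedge_part2Zr k m m' f f' g g' n n' :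
  k *: (m * n' + f * g' - q2 *: (g * f') + n * m')
  = m * (k *: n') + f * (k *: g') - q2 *: (g * (k *: f')) + n * (k *: m').
Proof.
by rewrite -!scalerAr !scalerDr scalerN !scalerA [q2 * k]mulrC.
Qed.

End WedgeIdentities.

Section Forms.
Context (R : realType) (q : R[i]).
Local Notation E := (degree_part q).

Definition mk_form (m : podles_sphere q) (f : E 2) (g : E (- 2))
  (n : podles_sphere q) : diff_form q := (m, (f, g), n).

Definition part0 (w : diff_form q) : podles_sphere q := w.1.1.
Definition part_plus (w : diff_form q) : E 2 := w.1.2.1.
Definition part_minus (w : diff_form q) : E (- 2) := w.1.2.2.
Definition part2 (w : diff_form q) : podles_sphere q := w.2.

Lemma mul00 : 0 + 0 = 0 :> int. Proof. by []. Qed.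
Lemma mul02 : 0 + 2 = 2 :> int. Proof. by []. Qed.
Lemma mul20 : 2 + 0 = 2 :> int. Proof. by []. Qed.
Lemma mul0N : 0 + (- 2) = - 2 :> int. Proof. by []. Qed.
Lemma mulN0 : - 2 + 0 = - 2 :> int. Proof. by []. Qed.
Lemma mul2N : 2 + (- 2) = 0 :> int. Proof. by []. Qed.
Lemma mulN2 : - 2 + 2 = 0 :> int. Proof. by []. Qed.

(* The last component encodes (f e^+)(g e^-) = f g tau and
   (g e^-)(f e^+) = - q^2 g f tau. Functions act on forms through multiplication
   of coefficients, on the right as well as on the left: the basis elements
   commute with degree-0 elements. *)
Definition wedge (w w' : diff_form q) : diff_form q :=
  mk_form
    (degree_mul mul00 (part0 w) (part0 w'))
    (degree_mul mul02 (part0 w) (part_plus w')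
       + degree_mul mul20 (part_plus w) (part0 w'))
    (degree_mul mul0N (part0 w) (part_minus w')
       + degree_mul mulN0 (part_minus w) (part0 w'))
    (degree_mul mul00 (part0 w) (part2 w')
       + degree_mul mul2N (part_plus w) (part_minus w')
       - q ^+ 2 *: degree_mul mulN2 (part_minus w) (part_plus w')
       + degree_mul mul00 (part2 w) (part0 w')).

Definition form_one : diff_form q := mk_form (degree_one q) 0 0 0.

Lemma formP (w w' : diff_form q) :
  part0 w = part0 w' :> su2 q -> part_plus w = part_plus w' :> su2 q ->
  part_minus w = part_minus w' :> su2 q -> part2 w = part2 w' :> su2 q -> w = w'.
Proof.
case: w w' => [[m [f g]] n] [[m' [f' g']] n'] /=.
by rewrite /part0 /part_plus /part_minus /part2 /= => /val_inj-> /val_inj-> /val_inj-> /val_inj->.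
Qed.

Lemma degree_mulE (j k l : int) (jkl : j + k = l) (u : E j) (v : E k) :
  degree_mul jkl u v = (u : su2 q) * (v : su2 q) :> su2 q.
Proof. by []. Qed.

Lemma degree_valD k (u v : E k) : u + v = (u : su2 q) + (v : su2 q) :> su2 q.
Proof. exact: (raddfD (val : E k -> su2 q)). Qed.

Lemma degree_valB k (u v : E k) : u - v = (u : su2 q) - (v : su2 q) :> su2 q.
Proof. exact: (raddfB (val : E k -> su2 q)). Qed.

Lemma degree_valZ k (c : R[i]) (u : E k) : c *: u = c *: (u : su2 q) :> su2 q.
Proof. by []. Qed.

Lemma degree_val0 k : (0 : E k) = 0 :> su2 q.
Proof. exact: (raddf0 (val : E k -> su2 q)). Qed.

Fact wedgeA : associative (@wedge).
Proof.
move=> w1 w2 w3; apply: formP => /=.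
- by rewrite mulrA.
- exact: wedge_part1A.
- exact: wedge_part1A.
- exact: wedge_part2A.
Qed.

Fact wedge1w : left_id form_one (@wedge).
Proof.
by move=> w; apply: formP; rewrite /= ?(mul1r, mul0r, scaler0, subr0, addr0).
Qed.

Fact wedgew1 : right_id form_one (@wedge).
Proof.
by move=> w; apply: formP;
  rewrite /= ?(mulr1, mulr0, scaler0, oppr0, addr0, add0r).
Qed.

Fact wedgeDl : left_distributive (@wedge) +%R.
Proof.
move=> w1 w2 w3; apply: formP => /=.
- exact: mulrDl.
- exact: wedge_part1D.
- exact: wedge_part1D.
- exact: wedge_part2D.
Qed.

Fact wedgeDr : right_distributive (@wedge) +%R.
Proof.
move=> w1 w2 w3; apply: formP => /=.
- exact: mulrDr.
- exact: wedge_part1Dr.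
- exact: wedge_part1Dr.
- exact: wedge_part2Dr.
Qed.

Fact form_one_neq0 : form_one != 0.
Proof.
apply/eqP => /(congr1 (fun w => degree_val (part0 w))) /= /eqP.
by rewrite oner_eq0.
Qed.

HB.instance Definition _ := GRing.Zmodule_isNzRing.Build (diff_form q)
  wedgeA wedge1w wedgew1 wedgeDl wedgeDr form_one_neq0.

Fact wedgeZl (k : R[i]) (w w' : diff_form q) : k *: (w * w') = (k *: w) * w'.
Proof.
apply: formP => /=.
- exact: scalerAl.
- exact: wedge_part1Z.
- exact: wedge_part1Z.
- exact: wedge_part2Z.
Qed.

HB.instance Definition _ :=
  GRing.Lmodule_isLalgebra.Build R[i] (diff_form q) wedgeZl.

Fact wedgeZr (k : R[i]) (w w' : diff_form q) : k *: (w * w') = w * (k *: w').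
Proof.
apply: formP => /=.
- exact: scalerAr.
- exact: wedge_part1Zr.
- exact: wedge_part1Zr.
- exact: wedge_part2Zr.
Qed.

HB.instance Definition _ :=
  GRing.Lalgebra_isAlgebra.Build R[i] (diff_form q) wedgeZr.

End Forms.

(* Omega^k as a subspace of the space of all forms; in particular the copy of  *)
(* the Podles sphere inside the forms is Omega q 0.                            *)
Definition Omega (R : realType) (q : R[i]) (k : nat) : set (diff_form q) :=
  match k with
  | 0%N => [set w | exists m, w = mk_form m 0 0 0]
  | 1%N => [set w | exists f g, w = mk_form 0 f g 0]
  | 2%N => [set w | exists n, w = mk_form 0 0 0 n]
  | _ => [set 0]
  end.

Arguments Omega {R} q k _.

Definition form_proj (R : realType) (q : R[i]) (k : nat) (w : diff_form q) :
    diff_form q :=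
  match k with
  | 0%N => mk_form (part0 w) 0 0 0
  | 1%N => mk_form 0 (part_plus w) (part_minus w) 0
  | 2%N => mk_form 0 0 0 (part2 w)
  | _ => 0
  end.

Section Operators.
Context (R : realType) (q : R[i]).

Definition tau : diff_form q := mk_form 0 0 0 (degree_one q).

(* kappa = - e^+ /\ e^-; e^+ alone is not a form, since 1 has degree 0, not 2. *)
Definition fundamental_form : diff_form q := - tau.

Definition lefschetz (w : diff_form q) : diff_form q := w * fundamental_form.

Definition hodge (w : diff_form q) : diff_form q :=
  mk_form (part2 w) ('i *: part_plus w) (- 'i *: part_minus w) (part0 w).

Definition hodge_inv (w : diff_form q) : diff_form q :=
  mk_form (part2 w) (- 'i *: part_plus w) ('i *: part_minus w) (part0 w).

Lemma hodgeK : cancel hodge hodge_inv.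
Proof.
move=> w; apply: formP => //=; rewrite scalerA ?mulrN ?mulNr -expr2 sqrCi.
  by rewrite opprK scale1r.
by rewrite opprK scale1r.
Qed.

Lemma hodge_invK : cancel hodge_inv hodge.
Proof.
move=> w; apply: formP => //=; rewrite scalerA ?mulrN ?mulNr -expr2 sqrCi.
  by rewrite opprK scale1r.
by rewrite opprK scale1r.
Qed.

Definition dual_lefschetz : diff_form q -> diff_form q :=
  hodge_inv \o lefschetz \o hodge.

Definition counting (w : diff_form q) : diff_form q :=
  \sum_(k < 3) (k%:R - 1) *: form_proj k w.

End Operators.

Definition sl2 (K : fieldType) : set 'M[K]_2 := [set X | \tr X = 0].

Definition lie_bracket (K : fieldType) (X Y : 'M[K]_2) : 'M[K]_2 :=
  X *m Y - Y *m X.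

Definition sl2_e (K : fieldType) : 'M[K]_2 := delta_mx 0 1.
Definition sl2_f (K : fieldType) : 'M[K]_2 := delta_mx 1 0.
Definition sl2_h (K : fieldType) : 'M[K]_2 := delta_mx 0 0 - delta_mx 1 1.

(* Only the values of rho on trace-zero matrices are meaningful. *)
Record sl2_representation (K : fieldType) (V : lmodType K)
    (rho : 'M[K]_2 -> V -> V) : Prop := {
  rep_endo : forall X, sl2 X -> linear (rho X);
  rep_linear : forall (c : K) X Y v, sl2 X -> sl2 Y ->
    rho (c *: X + Y) v = c *: rho X v + rho Y v;
  rep_bracket : forall X Y v, sl2 X -> sl2 Y ->
    rho (lie_bracket X Y) v = rho X (rho Y v) - rho Y (rho X v)
}.

Definition subspace (K : fieldType) (V : lmodType K) (U : set V) : Prop :=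
  U 0 /\ forall (c : K) u v, U u -> U v -> U (c *: u + v).

Definition subrepresentation (K : fieldType) (V : lmodType K)
    (rho : 'M[K]_2 -> V -> V) (U : set V) : Prop :=
  subspace U /\ forall X u, sl2 X -> U u -> U (rho X u).

Definition subspace_add (K : fieldType) (V : lmodType K) (U W : set V) : set V :=
  [set v | exists2 u, U u & exists2 w, W w & v = u + w].

Definition direct_sum (K : fieldType) (V : lmodType K) (S U W : set V) : Prop :=
  [/\ subspace U, subspace W, S = subspace_add U W & U `&` W = [set 0]].

(* The representation with e, f, h acting by L, Lambda, H: a trace-zero matrix  *)
(* X is X 0 1 *: e + X 1 0 *: f + X 0 0 *: h.                                   *)
Definition lefschetz_rep (R : realType) (q : R[i]) (X : 'M[R[i]]_2)
    (w : diff_form q) : diff_form q :=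
  X 0 1 *: lefschetz w + X 1 0 *: dual_lefschetz w + X 0 0 *: counting w.

Arguments lefschetz_rep {R} q X w.

(* Main.v *)
From HB Require Import structures.
Require Import Defs.
From mathcomp Require Import all_boot all_order all_algebra.
From mathcomp Require Import boolp classical_sets reals.
From mathcomp Require Import complex.

Set Implicit Arguments.
Unset Strict Implicit.
Unset Printing Implicit Defensive.

Import Order.TTheory GRing.Theory Num.Theory.
Local Open Scope ring_scope.
Local Open Scope classical_set_scope.

(** The wedge product with [- tau] kills everything but the degree-0 part, so
the three operators only see the outer components of a form
[w = m + f e^+ + g e^- + n tau]: [L w = - m tau], [Lambda w = - n] and
[H w = - m + n tau].  In terms of the pair [(n, - m)] they are therefore the
matrices [e], [f], [h] themselves: a trace-zero matrix [X] acts on [Omega] by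
multiplying the column [(n, - m)] by [X] and by annihilating the 1-forms
([lefschetz_repE]).  In other words, the forms are the sum of the defining
two-dimensional representation tensored with the Podles sphere, which occupies
degrees 0 and 2, and of a trivial representation in degree 1.  The
bracket relation is then the compatibility of this action with matrix products
([matrix_actM]), and both summands are visibly stable. *)

(** * The defining representation with coefficients in a module *)

Section MatrixAction.
Context (K : fieldType) (V : lmodType K).
Implicit Types (X Y : 'M[K]_2) (p : V * V) (c : K).

Definition matrix_act X p : V * V :=
  (X 0 0 *: p.1 + X 0 1 *: p.2, X 1 0 *: p.1 + X 1 1 *: p.2).

Lemma matrix_act_linear X : linear (matrix_act X).
Proof.
move=> c p p'; congr pair; rewrite /= !scalerDr addrACA !scalerA;
  by rewrite [X _ 0 * c]mulrC [X _ 1 * c]mulrC.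
Qed.

Lemma matrix_actDl c X Y p :
  matrix_act (c *: X + Y) p = c *: matrix_act X p + matrix_act Y p.
Proof.
by congr pair; rewrite /= !mxE !scalerDl scalerDr addrACA !scalerA.
Qed.

(** Associativity of matrix products, applied to a column with entries in [V];
it turns commutators of matrices into commutators of operators. *)
Lemma matrix_actM X Y p : matrix_act (X *m Y) p = matrix_act X (matrix_act Y p).
Proof.
by congr pair; rewrite /= !mxE !big_ord_recl !big_ord0 /= !addr0 !scalerDl;
  rewrite !scalerDr !scalerA addrACA;
  congr (_ *: _ + _ *: _ + (_ *: _ + _ *: _));
  congr (X _ _ * Y _ _); apply: val_inj.
Qed.

Lemma matrix_act_bracket X Y p :
  matrix_act (lie_bracket X Y) p
  = matrix_act X (matrix_act Y p) - matrix_act Y (matrix_act X p).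
Proof.
rewrite /lie_bracket addrC -scaleN1r matrix_actDl scaleN1r !matrix_actM.
by rewrite addrC.
Qed.

End MatrixAction.

Lemma sl2_lower (K : fieldType) (X : 'M[K]_2) : sl2 X -> X 1 1 = - X 0 0.
Proof.
rewrite /sl2 /= /mxtrace !big_ord_recl big_ord0 addr0 addrC => /eqP.
rewrite addr_eq0 => /eqP <-; congr (X _ _); exact: val_inj.
Qed.

(** * The operators on forms *)

Section LefschetzRepresentation.
Context (R : realType) (q : R[i]).
Local Notation V := (podles_sphere q).
Implicit Types (w : diff_form q) (X Y : 'M[R[i]]_2) (c : R[i]).

Lemma mk_formD m m' f f' g g' n n' :
  mk_form m f g n + mk_form m' f' g' n'
  = mk_form (m + m') (f + f') (g + g') (n + n') :> diff_form q.
Proof. by []. Qed.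

Lemma mk_formZ c m f g n :
  c *: mk_form m f g n
  = mk_form (c *: m) (c *: f) (c *: g) (c *: n) :> diff_form q.
Proof. by []. Qed.

Lemma mk_formN m f g n :
  - mk_form m f g n = mk_form (- m) (- f) (- g) (- n) :> diff_form q.
Proof. by []. Qed.

Lemma wedge_tau w : w * tau q = mk_form 0 0 0 (part0 w).
Proof.
by apply: formP; rewrite /= !(mulr0, mulr1, scaler0, oppr0, addr0).
Qed.

Lemma lefschetzE w : lefschetz w = mk_form 0 0 0 (- part0 w).
Proof.
by rewrite /lefschetz /fundamental_form mulrN wedge_tau mk_formN !oppr0.
Qed.

Lemma dual_lefschetzE w : dual_lefschetz w = mk_form (- part2 w) 0 0 0.
Proof.
rewrite /dual_lefschetz /= lefschetzE /hodge_inv /hodge.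
by rewrite /part0 /part_plus /part_minus /part2 /= !scaler0.
Qed.

Lemma countingE w : counting w = mk_form (- part0 w) 0 0 (part2 w).
Proof.
have coef2 : 2%:R - 1 = 1 :> R[i] by rewrite [2%:R]mulrS addrAC subrr add0r.
rewrite /counting !big_ord_recl big_ord0 /= sub0r subrr coef2.
rewrite scaleN1r scale0r scale1r add0r addr0 mk_formN mk_formD.
by rewrite !oppr0 !addr0 add0r.
Qed.

(** The sign makes the operators act on this pair by the matrices themselves. *)
Definition doublet w : V * V := (part2 w, - part0 w).

Definition doublet_form (p : V * V) : diff_form q := mk_form (- p.2) 0 0 p.1.

Lemma doublet_linear : linear doublet.
Proof. by move=> c w w'; congr pair; rewrite /= scalerN -opprD. Qed.

Lemma doublet_form_linear : linear doublet_form.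
Proof.
move=> c p p'; rewrite /doublet_form mk_formZ mk_formD !scaler0 !addr0.
by congr mk_form; rewrite scalerN -opprD.
Qed.

Lemma doublet_formK : cancel doublet_form doublet.
Proof. by case=> u v; rewrite /doublet /part0 /part2 /= opprK. Qed.

HB.instance Definition _ :=
  GRing.isLinear.Build R[i] (diff_form q) (V * V)%type _ doublet doublet_linear.
HB.instance Definition _ :=
  GRing.isLinear.Build R[i] (V * V)%type (diff_form q) _ doublet_form
    doublet_form_linear.

(** The diagonal of [X] is determined by one entry, so the coefficient of [H]
alone accounts for both diagonal terms; on 1-forms the action is zero because
[doublet] forgets them. *)
Lemma lefschetz_repE X w : sl2 X ->
  lefschetz_rep q X w = doublet_form (matrix_act X (doublet w)).
Proof.
move=> /sl2_lower X11; rewrite /lefschetz_rep.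
rewrite lefschetzE dual_lefschetzE countingE.
rewrite !mk_formZ !mk_formD !scaler0 !addr0 add0r /doublet_form /= X11.
by congr mk_form; rewrite ?[RHS]opprD !scalerN ?scaleNr ?opprK // addrC.
Qed.

Lemma sl2_representation_lefschetz : sl2_representation (lefschetz_rep q).
Proof.
split=> [X sX c w w'|c X Y w sX sY|X Y w sX sY].
- by rewrite !lefschetz_repE // linearP matrix_act_linear linearP.
- have sXY : sl2 (c *: X + Y).
    by rewrite /sl2 /= linearP /= sX sY mulr0 addr0.
  by rewrite !lefschetz_repE // matrix_actDl linearP.
- have sXY : sl2 (lie_bracket X Y).
    by rewrite /sl2 /= /lie_bracket raddfB /= mxtrace_mulC subrr.
  by rewrite !lefschetz_repE // !doublet_formK matrix_act_bracket raddfB.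
Qed.

(** * The decomposition *)

Lemma subspace_Omega k : subspace (Omega q k).
Proof.
case: k => [|[|[|k]]]; split=> /=.
- by exists 0.
- by move=> c _ _ [m ->] [m' ->]; exists (c *: m + m');
    rewrite mk_formZ mk_formD !scaler0 !addr0.
- by exists 0, 0.
- move=> c _ _ [f [g ->]] [f' [g' ->]]; exists (c *: f + f'), (c *: g + g').
  by rewrite mk_formZ mk_formD !scaler0 !addr0.
- by exists 0.
- by move=> c _ _ [n ->] [n' ->]; exists (c *: n + n');
    rewrite mk_formZ mk_formD !scaler0 !addr0.
- by [].
- by move=> c _ _ -> ->; rewrite scaler0 addr0.
Qed.

Lemma doublet_Omega1 w : Omega q 1 w -> doublet w = 0.
Proof. by case=> [f [g ->]]; rewrite /doublet /part0 /part2 /= oppr0. Qed.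

(** This identifies the degrees 0 and 2 with pairs of functions; stability and
independence of 1-forms then follow from [lefschetz_repE], [doublet_formK] and
[doublet_Omega1]. *)
Lemma Omega02E : subspace_add (Omega q 0) (Omega q 2) = range doublet_form.
Proof.
apply/seteqP; split=> [_ [_ [m ->] [_ [n ->] ->]]|_ [[n m] _ <-]].
  by exists (n, - m); rewrite // /doublet_form mk_formD /= opprK !addr0 add0r.
exists (mk_form (- m) 0 0 0); first by exists (- m).
exists (mk_form 0 0 0 n); first by exists n.
by rewrite mk_formD !addr0 add0r.
Qed.

Lemma subspace_Omega02 : subspace (subspace_add (Omega q 0) (Omega q 2)).
Proof.
rewrite Omega02E; split; first by exists 0; rewrite ?raddf0.
by move=> c _ _ [p _ <-] [p' _ <-]; exists (c *: p + p'); rewrite ?linearP.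
Qed.

Lemma direct_sum_Omega02 :
  direct_sum (subspace_add (Omega q 0) (Omega q 2)) (Omega q 0) (Omega q 2).
Proof.
split=> //; try exact: subspace_Omega.
apply/seteqP; split=> [w [[m ->] [n [-> _]]] //|_ ->].
by split; exists 0.
Qed.

Lemma direct_sum_Omega :
  direct_sum [set: diff_form q]
    (subspace_add (Omega q 0) (Omega q 2)) (Omega q 1).
Proof.
split; [exact: subspace_Omega02|exact: subspace_Omega| |].
- apply/seteqP; split=> // w _; rewrite Omega02E.
  exists (doublet_form (doublet w)); first by exists (doublet w).
  exists (mk_form 0 (part_plus w) (part_minus w) 0).
    by exists (part_plus w), (part_minus w).
  rewrite /doublet_form mk_formD /= opprK !addr0 !add0r.
  by case: w => [[m [f g]] n].
- rewrite Omega02E; apply/seteqP; split=> [_ [[p _ <-] /doublet_Omega1]|_ ->].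
    by rewrite doublet_formK => ->; rewrite raddf0.
  by split; [exists 0; rewrite ?raddf0|exists 0, 0].
Qed.

Lemma subrepresentation_Omega02 :
  subrepresentation (lefschetz_rep q)
    (subspace_add (Omega q 0) (Omega q 2)).
Proof.
split=> [|X w sX _]; first exact: subspace_Omega02.
by rewrite Omega02E lefschetz_repE //; exists (matrix_act X (doublet w)).
Qed.

Lemma subrepresentation_Omega1 :
  subrepresentation (lefschetz_rep q) (Omega q 1).
Proof.
split=> [|X w sX /doublet_Omega1 w1]; first exact: subspace_Omega.
rewrite lefschetz_repE // w1 /matrix_act !scaler0 addr0.
by exists 0, 0; rewrite /doublet_form oppr0.
Qed.

Lemma lefschetz_rep_e w : lefschetz_rep q (sl2_e _) w = lefschetz w.
Proof.
by rewrite /lefschetz_rep /sl2_e !mxE /= scale1r !scale0r !addr0.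
Qed.

Lemma lefschetz_rep_f w : lefschetz_rep q (sl2_f _) w = dual_lefschetz w.
Proof.
by rewrite /lefschetz_rep /sl2_f !mxE /= scale1r !scale0r addr0 add0r.
Qed.

Lemma lefschetz_rep_h w : lefschetz_rep q (sl2_h _) w = counting w.
Proof.
by rewrite /lefschetz_rep /sl2_h !mxE /= !subr0 scale1r !scale0r !add0r.
Qed.

End LefschetzRepresentation.

Theorem mainTheorem6 (R : realType) (q : R[i]) (hq : q != 0) :
  let rho := lefschetz_rep q in
  [/\ [/\ sl2_representation rho,
          forall w, rho (sl2_e _) w = lefschetz w,
          forall w, rho (sl2_f _) w = dual_lefschetz w
        & forall w, rho (sl2_h _) w = counting w],
      direct_sum [set: diff_form q]
        (subspace_add (Omega q 0) (Omega q 2)) (Omega q 1),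
      direct_sum (subspace_add (Omega q 0) (Omega q 2))
        (Omega q 0) (Omega q 2),
      subrepresentation rho (subspace_add (Omega q 0) (Omega q 2))
    & subrepresentation rho (Omega q 1)].
Proof.
split; first split.
- exact: sl2_representation_lefschetz.
- exact: lefschetz_rep_e.
- exact: lefschetz_rep_f.
- exact: lefschetz_rep_h.
- exact: direct_sum_Omega.
- exact: direct_sum_Omega02.
- exact: subrepresentation_Omega02.
- exact: subrepresentation_Omega1.
Qed.
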